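(* Let $k$ be a field with separable closure $k^s$, $G$ a reductive group over $k$ with a finite-dimensional representation $\rho:G\to\mathrm{GL}(V)$ over $k$, and $f \in (V/\!\!/G)(k)$ a rational invariant such that $G(k^s)$ acts transitively on $V_f(k^s)$ with abelian stabilizers. Then $d_f = 0$ in $H^2(k,G_f)$ if and only if there exists a pure inner form $G^c$ of $G$ (with $c$ a $1$-cocycle with values in $G(k^s)$) such that $V_f^c(k)$ is nonempty. In particular, when $H^1(k,G) = 1$, the condition $d_f = 0$ is necessary and sufficient for $V_f(k)$ to be nonempty (i.e. for the existence of $G(k)$-orbits on $V_f(k)$).
   Context: $V/\!\!/G=\mathrm{Spec}(\mathrm{Sym}^*(V^\vee)^G)$, $V_f$ the fiber over $f$ of $V\to V/\!\!/G$. $G_f$: for $v\in V_f(k^s)$, $\sigma\in\mathrm{Gal}(k^s/k)$ choose $g_\sigma\in G(k^s)$ with $g_\sigma\,{}^\sigma v=v$; conjugation by $g_\sigma$ gives well-defined isomorphisms ${}^\sigma(G_v)\to G_v$ (stabilizers being abelian), which are descent data; $G_f$ is the resulting commutative $k$-group scheme with isomorphisms $\iota_v:G_f(k^s)\to G_v$ satisfying $\iota_{hv}(b)=h\iota_v(b)h^{-1}$ and ${}^\sigma(\iota_v(b))=\iota_{{}^\sigma v}({}^\sigma b)$. $d_f\in H^2(k,G_f)$ is the class of the $2$-cocycle $d_{\sigma,\tau}=\iota_v^{-1}(g_\sigma\,{}^\sigma g_\tau\,g_{\sigma\tau}^{-1})$ (independent of choices). Pure inner form: for a $1$-cocycle $c$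 with values in $G(k^s)$, $G^c(k^s)=G(k^s)$ with Galois action $\sigma*h=c_\sigma\,{}^\sigma h\,c_\sigma^{-1}$; choosing $g\in\mathrm{GL}(V)(k^s)$ with $\rho(c_\sigma)=g^{-1}\,{}^\sigma g$, $G^c$ acts on $V$ over $k$ via $h\mapsto g\rho(h)g^{-1}$, and $V_f^c(k):=V(k)\cap gV_f(k^s)$. *)

(* Defs.v *)
From HB Require Import structures.
From mathcomp Require Import all_boot all_order all_algebra all_field.
From mathcomp Require Import mpoly.
From mathcomp Require Import boolp.

Set Implicit Arguments.
Unset Strict Implicit.
Unset Printing Implicit Defensive.

Import GRing.Theory.
Local Open Scope ring_scope.
Local Obligation Tactic := idtac.

(* A commutative algebra over k is a ring morphism out of k; this makes an
   infinite field extension of k a k-algebra without further structure. *)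
Record kAlg (k : fieldType) := KAlg {
  kalg_ring :> comNzRingType;
  kalg_map : {rmorphism k -> kalg_ring} }.

Record kHom (k : fieldType) (A B : kAlg k) := KHom {
  khom_map :> {rmorphism A -> B};
  khom_comm : forall x : k, khom_map (kalg_map A x) = kalg_map B x }.

Lemma kHom_ext (k : fieldType) (A B : kAlg k) (u v : kHom A B) :
  u =1 v -> u = v.
Proof.
case: u v => [u cu] [v cv] /= uv.
have e : u = v.
  move: u v {cu cv} uv => [u [[a] [b]]] [v [[c] [d]]] /= /funext e.
  move: e a b c d => <- a b c d.
  by rewrite (Prop_irrelevance a c) (Prop_irrelevance b d).
by move: e cu cv {uv} => -> cu cv; rewrite (Prop_irrelevance cu cv).
Qed.

Definition kHom_id (k : fieldType) (A : kAlg k) : kHom A A :=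
  @KHom k A A (idfun : {rmorphism A -> A}) (fun=> erefl).

Program Definition kHom_comp (k : fieldType) (A B C : kAlg k)
    (v : kHom B C) (u : kHom A B) : kHom A C :=
  @KHom k A C (v \o u : {rmorphism A -> C}) _.
Next Obligation. by move=> k A B C v u x /=; rewrite !khom_comm. Qed.

Definition kAlg_base (k : fieldType) : kAlg k :=
  @KAlg k k (idfun : {rmorphism k -> k}).

Definition kAlg_restr (k K : fieldType) (j : {rmorphism k -> K}) (S : kAlg K) :
  kAlg k := @KAlg k S (kalg_map S \o j : {rmorphism k -> S}).

Program Definition kHom_restr (k K : fieldType) (j : {rmorphism k -> K})
    (S T : kAlg K) (u : kHom S T) : kHom (kAlg_restr j S) (kAlg_restr j T) :=
  @KHom k (kAlg_restr j S) (kAlg_restr j T) (khom_map u) _.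
Next Obligation. by move=> k K j S T u x /=; rewrite khom_comm. Qed.

Record groupFunctor (k : fieldType) := GroupFunctor {
  pts :> kAlg k -> Type;
  pmap : forall S T : kAlg k, kHom S T -> pts S -> pts T;
  pone : forall S, pts S;
  pmul : forall S, pts S -> pts S -> pts S;
  pinv : forall S, pts S -> pts S;
  pmap_id : forall S (x : pts S), pmap (kHom_id S) x = x;
  pmap_comp : forall S T U (v : kHom T U) (u : kHom S T) (x : pts S),
    pmap (kHom_comp v u) x = pmap v (pmap u x);
  pmap_mul : forall S T (u : kHom S T) (x y : pts S),
    pmap u (pmul x y) = pmul (pmap u x) (pmap u y);
  pmulA : forall S, associative (@pmul S);
  pmul1 : forall S, left_id (pone S) (@pmul S);
  pmulV : forall S, left_inverse (pone S) (@pinv S) (@pmul S) }.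

Arguments pmap {k} g {S T} _ _.
Arguments pone {k} g S.
Arguments pmul {k g S}.
Arguments pinv {k g S}.

(* By Yoneda, u is the universal point, i.e. the identity of Spec O. *)
Definition represents (k : fieldType) (G : groupFunctor k) (O : kAlg k)
    (u : G O) : Prop :=
  forall (S : kAlg k) (x : G S), exists! phi : kHom O S, pmap G phi u = x.

Definition affine_group (k : fieldType) (G : groupFunctor k) : Prop :=
  exists (O : kAlg k) (u : G O), represents u.

Definition finitely_generated (k : fieldType) (O : kAlg k) : Prop :=
  exists (m : nat) (s : 'I_m -> O),
    forall a : O, exists p : {mpoly k[m]}, a = mmap (kalg_map O) s p.

Definition algebraic_group (k : fieldType) (G : groupFunctor k) : Prop :=
  exists (O : kAlg k) (u : G O), represents u /\ finitely_generated O.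

Definition commutative_group (k : fieldType) (G : groupFunctor k) : Prop :=
  forall S : kAlg k, commutative (@pmul k G S).

(* The infinitesimal lifting criterion; smoothness for G of finite type. *)
Definition formally_smooth (k : fieldType) (G : groupFunctor k) : Prop :=
  forall (S T : kAlg k) (q : kHom S T),
    (forall t : T, exists s : S, q s = t) ->
    (forall a b : S, q a = 0 -> q b = 0 -> a * b = 0) ->
    forall y : G T, exists x : G S, pmap G q x = y.

Program Definition base_change (k K : fieldType) (j : {rmorphism k -> K})
    (G : groupFunctor k) : groupFunctor K :=
  @GroupFunctor K (fun S => G (kAlg_restr j S))
    (fun S T u => pmap G (kHom_restr j u))
    (fun S => pone G (kAlg_restr j S))
    (fun S => @pmul k G (kAlg_restr j S))
    (fun S => @pinv k G (kAlg_restr j S)) _ _ _ _ _ _.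
Next Obligation.
move=> k K j G S x /=; rewrite -[RHS]pmap_id; congr (pmap G _ x).
exact: kHom_ext.
Qed.
Next Obligation.
move=> k K j G S T U v u x /=; rewrite -pmap_comp; congr (pmap G _ x).
exact: kHom_ext.
Qed.
Next Obligation. by move=> k K j G S T u x y /=; rewrite pmap_mul. Qed.
Next Obligation. by move=> k K j G S /=; exact: pmulA. Qed.
Next Obligation. by move=> k K j G S /=; exact: pmul1. Qed.
Next Obligation. by move=> k K j G S /=; exact: pmulV. Qed.

(* A morphism of group functors G -> GL_n; rep_mx takes invertible values
   since the source is a group. *)
Record representation (k : fieldType) (G : groupFunctor k) (n : nat) := Rep {
  rep_mx :> forall S : kAlg k, G S -> 'M[S]_n;
  rep_nat : forall (S T : kAlg k) (u : kHom S T) (x : G S),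
    rep_mx (pmap G u x) = map_mx u (rep_mx x);
  rep_one : forall S : kAlg k, rep_mx (pone G S) = 1%:M;
  rep_mul : forall (S : kAlg k) (x y : G S),
    rep_mx (pmul x y) = rep_mx x *m rep_mx y }.

Arguments rep_mx {k G n} r {S} _.

(* By Yoneda, the elements of the coordinate ring of an affine G. *)
Record regular_function (k : fieldType) (G : groupFunctor k) := RegFun {
  regf :> forall S : kAlg k, G S -> S;
  regf_nat : forall (S T : kAlg k) (u : kHom S T) (x : G S),
    regf (pmap G u x) = u (regf x) }.

Arguments regf {k G} r {S} _.

Section UnipotentRadical.

Variables (K : fieldType) (G : groupFunctor K).
Let GK := G (kAlg_base K).

Definition zariski_closed (Z : GK -> Prop) : Prop :=
  exists I : regular_function G -> Prop,
    forall x : GK, Z x <-> (forall F, I F -> regf F x = 0).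

Definition zariski_connected (Z : GK -> Prop) : Prop :=
  forall Z1 Z2 : GK -> Prop, zariski_closed Z1 -> zariski_closed Z2 ->
    (forall x, Z x <-> Z1 x \/ Z2 x) ->
    (forall x, ~ (Z1 x /\ Z2 x)) ->
    (forall x, ~ Z1 x) \/ (forall x, ~ Z2 x).

Definition normal_subgroup (N : GK -> Prop) : Prop :=
  [/\ N (pone G _),
      forall x y, N x -> N y -> N (pmul x y),
      forall x, N x -> N (pinv x) &
      forall h x, N x -> N (pmul (pmul h x) (pinv h))].

Definition unipotent (x : GK) : Prop :=
  forall (m : nat) (r : representation G m),
    exists e : nat, iter e (mulmx (rep_mx r x - 1%:M)) 1%:M = 0.

(* For K algebraically closed and G affine of finite type over K, closed
   subsets of G(K) correspond to reduced closed subschemes of G, and reduced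
   subgroup schemes are smooth. *)
Definition trivial_unipotent_radical : Prop :=
  forall N : GK -> Prop,
    zariski_closed N -> zariski_connected N -> normal_subgroup N ->
    (forall x, N x -> unipotent x) ->
    forall x, N x -> x = pone G _.

End UnipotentRadical.

Definition is_algebraic_closure (k K : fieldType) (j : {rmorphism k -> K}) :
  Prop :=
  GRing.closed_field_axiom K /\ (forall x : K, algebraicOver j x).

Definition reductive (k : fieldType) (G : groupFunctor k) : Prop :=
  [/\ algebraic_group G, formally_smooth G &
      forall (K : fieldType) (j : {rmorphism k -> K}),
        is_algebraic_closure j -> trivial_unipotent_radical (base_change j G)].

(* separable_poly p means that p is coprime to its derivative. *)
Definition is_separable_closure (k ks : fieldType) (i : {rmorphism k -> ks}) :
  Prop :=
  (forall x : ks, exists p : {poly k},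
      separable_poly p /\ root (map_poly i p) x) /\
  (forall p : {poly ks}, separable_poly p -> (1 < size p)%N ->
      exists x : ks, root p x).

Section Invariants.

Variables (k : fieldType) (G : groupFunctor k) (n : nat).
Variable rho : representation G n.

Definition evalV (S : kAlg k) (v : 'cV[S]_n) (p : {mpoly k[n]}) : S :=
  mmap (kalg_map S) (fun i => v i 0) p.

(* Sym^*(V^vee) is {mpoly k[n]} for V = k^n; testing invariance on all
   S-valued points tests it on the universal one. *)
Definition invariant (p : {mpoly k[n]}) : Prop :=
  forall (S : kAlg k) (g : G S) (v : 'cV[S]_n),
    evalV (rep_mx rho g *m v) p = evalV v p.

Definition invariant_pred : {pred {mpoly k[n]}} :=
  fun p => `[< invariant p >].

Lemma invariant_subring : subring_closed invariant_pred.
Proof.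
split=> [|p q|p q]; rewrite /invariant_pred !unfold_in.
- by apply/asboolP => S g v; rewrite /evalV !rmorph1.
- move=> /asboolP hp /asboolP hq; apply/asboolP => S g v.
  by move: (hp S g v) (hq S g v); rewrite /evalV !rmorphB /= => -> ->.
- move=> /asboolP hp /asboolP hq; apply/asboolP => S g v.
  by move: (hp S g v) (hq S g v); rewrite /evalV !rmorphM /= => -> ->.
Qed.

HB.instance Definition _ :=
  GRing.isSubringClosed.Build {mpoly k[n]} invariant_pred invariant_subring.

Record invPoly := InvPoly {
  inv_poly :> {mpoly k[n]};
  inv_polyP : inv_poly \in invariant_pred }.

HB.instance Definition _ := [isSub for inv_poly].
HB.instance Definition _ := [Choice of invPoly by <:].
HB.instance Definition _ := [SubChoice_isSubComNzRing of invPoly by <:].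

Lemma invariantC (c : k) : c%:MP \in invariant_pred.
Proof. by rewrite unfold_in; apply/asboolP => S g v; rewrite /evalV !mmapC. Qed.

Definition inv_const (c : k) : invPoly := InvPoly (invariantC c).

Lemma inv_const_zmod : zmod_morphism inv_const.
Proof. by move=> a b; apply: val_inj; rewrite /= mpolyCB. Qed.

Lemma inv_const_monoid : monoid_morphism inv_const.
Proof. by split=> [|a b]; apply: val_inj; rewrite //= mpolyCM. Qed.

HB.instance Definition _ :=
  GRing.isZmodMorphism.Build k invPoly inv_const inv_const_zmod.
HB.instance Definition _ :=
  GRing.isMonoidMorphism.Build k invPoly inv_const inv_const_monoid.

(* The coordinate ring of V // G. *)
Definition inv_ring : kAlg k :=
  @KAlg k invPoly (inv_const : {rmorphism k -> invPoly}).

Definition quotient_point : Type := kHom inv_ring (kAlg_base k).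

Definition fiber (f : quotient_point) (S : kAlg k) (v : 'cV[S]_n) : Prop :=
  forall p : invPoly, evalV v p = kalg_map S (f p).

End Invariants.

Section Galois.

Variables (k ks : fieldType) (i : {rmorphism k -> ks}).

Definition kAlg_sep : kAlg k := @KAlg k ks i.

Record galAut := GalAut {
  gal_hom :> kHom kAlg_sep kAlg_sep;
  gal_bij : bijective gal_hom }.

Definition gal_mul (s t : galAut) : galAut :=
  @GalAut (kHom_comp s t) (bij_comp (gal_bij s) (gal_bij t)).

(* Basic neighbourhoods in the Krull topology. *)
Definition gal_agree (l : seq ks) (s t : galAut) : Prop :=
  forall x : ks, x \in l -> s x = t x.

Definition continuous1 (T : Type) (c : galAut -> T) : Prop :=
  forall s, exists l : seq ks, forall s', gal_agree l s s' -> c s' = c s.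

Definition continuous2 (T : Type) (d : galAut -> galAut -> T) : Prop :=
  forall s t, exists l : seq ks, forall s' t',
    gal_agree l s s' -> gal_agree l t t' -> d s' t' = d s t.

Section Cohomology.

Variable A : groupFunctor k.

Definition gal_act (s : galAut) (x : A kAlg_sep) : A kAlg_sep := pmap A s x.

Definition Z1 (c : galAut -> A kAlg_sep) : Prop :=
  continuous1 c /\
  (forall s t, c (gal_mul s t) = pmul (c s) (gal_act s (c t))).

Definition H1_trivial : Prop :=
  forall c, Z1 c ->
    exists h : A kAlg_sep, forall s, c s = pmul (pinv h) (gal_act s h).

(* Z2 and H2 are only used for commutative A. *)
Definition Z2 (d : galAut -> galAut -> A kAlg_sep) : Prop :=
  continuous2 d /\
  (forall s t r,
     pmul (gal_act s (d t r)) (d s (gal_mul t r)) =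
     pmul (d (gal_mul s t) r) (d s t)).

Definition cobound (e : galAut -> A kAlg_sep) (s t : galAut) : A kAlg_sep :=
  pmul (pmul (e s) (gal_act s (e t))) (pinv (e (gal_mul s t))).

Definition cohomologous2 (d d' : galAut -> galAut -> A kAlg_sep) : Prop :=
  exists e : galAut -> A kAlg_sep, continuous1 e /\
    (forall s t, d' s t = pmul (d s t) (cobound e s t)).

(* An element of H^2 is a cohomology class, as a set of cocycles. *)
Definition H2_class (d : galAut -> galAut -> A kAlg_sep) :
  (galAut -> galAut -> A kAlg_sep) -> Prop :=
  fun d' => Z2 d' /\ cohomologous2 d d'.

Definition H2_zero := H2_class (fun _ _ => pone A kAlg_sep).

End Cohomology.

Variables (G : groupFunctor k) (n : nat) (rho : representation G n).
Variable f : quotient_point rho.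

Definition fixes (v : 'cV[ks]_n) (h : G kAlg_sep) : Prop :=
  rep_mx rho h *m v = v.

Definition transitive_on_fiber : Prop :=
  (exists v : 'cV[ks]_n, fiber f (v : 'cV[kAlg_sep]_n)) /\
  (forall v w : 'cV[ks]_n,
     fiber f (v : 'cV[kAlg_sep]_n) -> fiber f (w : 'cV[kAlg_sep]_n) ->
     exists h : G kAlg_sep, rep_mx rho h *m v = w).

Definition abelian_stabilizers : Prop :=
  forall v : 'cV[ks]_n, fiber f (v : 'cV[kAlg_sep]_n) ->
    forall a b : G kAlg_sep, fixes v a -> fixes v b -> pmul a b = pmul b a.

(* A k-group scheme Gf together with isomorphisms iota v : Gf(ks) -> G_v for
   v in V_f(ks), as produced by descent. *)
Record stabilizer_descent := StabilizerDescent {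
  Gf :> groupFunctor k;
  Gf_affine : affine_group Gf;
  Gf_comm : commutative_group Gf;
  iota : 'cV[ks]_n -> Gf kAlg_sep -> G kAlg_sep;
  iota_mul : forall v, fiber f (v : 'cV[kAlg_sep]_n) ->
    forall a b, iota v (pmul a b) = pmul (iota v a) (iota v b);
  iota_inj : forall v, fiber f (v : 'cV[kAlg_sep]_n) -> injective (iota v);
  iota_img : forall v, fiber f (v : 'cV[kAlg_sep]_n) ->
    forall h, fixes v h <-> exists b, iota v b = h;
  iota_conj : forall v, fiber f (v : 'cV[kAlg_sep]_n) ->
    forall h b,
      iota (rep_mx rho h *m v) b = pmul (pmul h (iota v b)) (pinv h);
  iota_gal : forall v, fiber f (v : 'cV[kAlg_sep]_n) ->
    forall (s : galAut) b,
      gal_act s (iota v b) = iota (map_mx s v) (gal_act s b) }.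

(* d is the 2-cocycle attached to the choices of v and of g. *)
Definition df_cocycle (D : stabilizer_descent) (v : 'cV[ks]_n)
    (g : galAut -> G kAlg_sep) (d : galAut -> galAut -> D kAlg_sep) : Prop :=
  [/\ fiber f (v : 'cV[kAlg_sep]_n),
      continuous1 g,
      forall s, rep_mx rho (g s) *m map_mx s v = v &
      forall s t, @iota D v (d s t) =
        pmul (pmul (g s) (gal_act s (g t))) (pinv (g (gal_mul s t)))].

(* The cohomology class common to all choices. *)
Definition df (D : stabilizer_descent) :
  (galAut -> galAut -> D kAlg_sep) -> Prop :=
  fun d' => exists v g d, df_cocycle v g d /\ H2_class d d'.

Definition trivializes (g : 'M[ks]_n) (c : galAut -> G kAlg_sep) : Prop :=
  g \in unitmx /\ (forall s, rep_mx rho (c s) = invmx g *m map_mx s g).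

(* V_f^c(k), where g trivializes the image of c in GL(V)(ks). *)
Definition twisted_fiber (g : 'M[ks]_n) (w : 'cV[k]_n) : Prop :=
  exists v : 'cV[ks]_n,
    fiber f (v : 'cV[kAlg_sep]_n) /\ map_mx i w = g *m v.

End Galois.

Arguments kAlg_sep {k ks} i.
Arguments H1_trivial {k ks} i A.
Arguments H2_zero {k ks} i A.
Arguments transitive_on_fiber {k ks} i {G n rho} f.
Arguments abelian_stabilizers {k ks} i {G n rho} f.
Arguments stabilizer_descent {k ks} i {G n rho} f.
Arguments iota {k ks i G n rho f} D v b : rename.
Arguments df {k ks i G n rho f} D d' : rename.
Arguments twisted_fiber {k ks} i {G n rho} f g w.
Arguments trivializes {k ks i G n} rho g c.

(* Main.v *)
From HB Require Import structures.
From mathcomp Require Import all_boot all_order all_algebra all_field.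
From mathcomp Require Import mpoly boolp.
From mathcomp Require classical_sets.
(* [Defs] comes last because [galois] also exports a [gal_mul]. *)
Require Import Defs.

Set Implicit Arguments.
Unset Strict Implicit.
Unset Printing Implicit Defensive.

Import GRing.Theory.
Local Open Scope ring_scope.

(* Both sides are equivalent to the existence of a 1-cocycle [c] with values in
   [G(ks)] and of [v] in [V_f(ks)] with [c_s (s v) = v] for all [s].
   - If [d_f] is killed by the cochain [e], then [c_s = iota_v(e_s) g_s] is such
     a cocycle.  Conversely such a [c] is an admissible choice of [g] with trivial
     [d], and any other choice gives a coboundary because [G(ks)] is transitive on
     [V_f(ks)].
   - Given [c] and [v], Hilbert 90 for [GL_n] provides [g] with
     [rho(c_s) = g^-1 (s g)], so [g v] is Galois invariant, hence rational.
   The fixed field of the automorphisms of [ks] is [k] because a partial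
   automorphism extends to [ks] by Zorn's lemma.  For Hilbert 90, a continuous
   cocycle depends on [s] only through the images of a finite list [l], which has
   a finite orbit; summing the cocycle over this orbit against Galois equivariant
   functions gives enough invariant vectors, as these functions separate points. *)

(** * Partial automorphisms of the separable closure and their action on polynomials *)

Section PartialAutomorphisms.

Variables (k ks : fieldType) (i : {rmorphism k -> ks}).
Hypothesis hks : is_separable_closure i.

(* The graphs of isomorphisms between two [k]-subalgebras of [ks]; see [paut_inj]
   for injectivity. *)
Record partial_aut (R : ks -> ks -> Prop) : Prop := PartialAut {
  paut_base : forall a, R (i a) (i a);
  pautB : forall x y x' y', R x y -> R x' y' -> R (x - x') (y - y');
  pautM : forall x y x' y', R x y -> R x' y' -> R (x * x') (y * y');
  paut0 : forall y, R 0 y -> y = 0 }.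

Definition coefwise (R : ks -> ks -> Prop) (p q : {poly ks}) : Prop :=
  forall j, R p`_j q`_j.

Section Closure.

Variables (R : ks -> ks -> Prop) (hR : partial_aut R).

Lemma paut00 : R 0 0.
Proof. by have := paut_base hR 0; rewrite rmorph0. Qed.

Lemma pautN x y : R x y -> R (- x) (- y).
Proof. by move=> h; have := pautB hR paut00 h; rewrite !sub0r. Qed.

Lemma pautD x y x' y' : R x y -> R x' y' -> R (x + x') (y + y').
Proof. by move=> h /pautN h'; have := pautB hR h h'; rewrite !opprK. Qed.

Lemma paut_fun x y y' : R x y -> R x y' -> y = y'.
Proof.
by move=> h h'; have := pautB hR h h'; rewrite subrr => /(paut0 hR)/subr0_eq.
Qed.

Lemma coefwiseB p q p' q' :
  coefwise R p q -> coefwise R p' q' -> coefwise R (p - p') (q - q').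
Proof. by move=> h h' j; rewrite !coefB; apply: pautB. Qed.

Lemma coefwiseM p q p' q' :
  coefwise R p q -> coefwise R p' q' -> coefwise R (p * p') (q * q').
Proof.
move=> h h' j; rewrite !coefM.
by elim/big_ind2: _ => [|*|*]; [exact: paut00|exact: pautD|exact: pautM].
Qed.

Lemma coefwiseC x y : R x y -> coefwise R x%:P y%:P.
Proof. by move=> h j; rewrite !coefC; case: eqP => // _; exact: paut00. Qed.

Lemma coefwiseX : coefwise R 'X 'X.
Proof.
move=> j; rewrite !coefX; case: eqP => _ /=; last exact: paut00.
by rewrite -(rmorph1 i); exact: paut_base.
Qed.

Lemma coefwise_map (p : {poly k}) : coefwise R (map_poly i p) (map_poly i p).
Proof. by move=> j; rewrite coef_map; exact: paut_base. Qed.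

Lemma coefwiseXn m : coefwise R 'X^m 'X^m.
Proof.
elim: m => [|m IH]; last first.
  by rewrite exprS; apply: coefwiseM => //; exact: coefwiseX.
by rewrite expr0; apply: coefwiseC; rewrite -(rmorph1 i); exact: paut_base.
Qed.

Lemma coefwise_horner p q x y : coefwise R p q -> R x y -> R p.[x] q.[y].
Proof.
move=> h hxy.
have -> : p.[x] = \sum_(j < maxn (size p) (size q)) p`_j * x ^+ j.
  exact: horner_coef_wide (leq_maxl _ _).
have -> : q.[y] = \sum_(j < maxn (size p) (size q)) q`_j * y ^+ j.
  exact: horner_coef_wide (leq_maxr _ _).
elim/big_ind2: _ => [|*|j _]; [exact: paut00|exact: pautD|].
apply: pautM => //; elim: (nat_of_ord j) => [|m IH].
  by rewrite !expr0 -(rmorph1 i); exact: paut_base.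
by rewrite !exprS; apply: pautM.
Qed.

(* A nonzero [x] is a root of a polynomial over [k] with nonzero constant term,
   and [R] maps its value at [x] to its value at the image of [x]. *)
Lemma paut_inj x : R x 0 -> x = 0.
Proof.
move=> hx; have [p [sp rp]] := hks.1 x.
have p0 := separable_poly_neq0 sp.
move: rp; have [m] := ubnP (size p).
move: p p0 {sp}; elim: m => // m IH p p0 sm rp; apply/eqP/negP => /negP xn0.
have hv : R 0 (map_poly i p).[0].
  by have := coefwise_horner (coefwise_map p) hx; rewrite (rootP rp).
have := paut0 hR hv; rewrite horner_coef0 coef_map => /eqP; rewrite fmorph_eq0.
rewrite -horner_coef0 => /factor_theorem[q Eq].
have q0 : q != 0 by apply: contraNneq p0 => e; rewrite Eq e mul0r.
have : x = 0; last by apply/eqP.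
apply: (IH q) => //.
  by move: sm; rewrite Eq subr0 size_mulX.
by move: rp; rewrite Eq subr0 rmorphM /= map_polyX rootM rootX (negPf xn0) orbF.
Qed.

(** A coefficient of [p] vanishes exactly when that of [q] does, by [paut_inj] and [paut0]. *)
Lemma coefwise_size p q : coefwise R p q -> size p = size q.
Proof.
move=> h; apply/eqP; rewrite eqn_leq; apply/andP; split; apply/leq_sizeP => j sj.
  by apply: paut_inj; have := h j; rewrite (nth_default _ sj).
by apply: (paut0 hR); have := h j; rewrite (nth_default _ sj).
Qed.

End Closure.

Lemma partial_aut_sym R : partial_aut R -> partial_aut (fun x y => R y x).
Proof.
move=> hR; split.
- exact: paut_base hR.
- by move=> *; exact: pautB hR _ _ _ _ _ _.
- by move=> *; exact: pautM hR _ _ _ _ _ _.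
- by move=> y; exact: paut_inj hR _.
Qed.

(** Here [p] is a minimal polynomial of [x] over the domain of [R], up to a scalar, and [q] is its
    conjugate under [R]. It is not taken monic, since [partial_aut] does not provide inverses. *)
Definition min_pair (R : ks -> ks -> Prop) (x : ks) (p q : {poly ks}) : Prop :=
  [/\ coefwise R p q, p != 0, root p x &
      forall p' q', coefwise R p' q' -> root p' x -> (size p' < size p)%N ->
        p' = 0].

(** * Extending a partial automorphism to one more element *)

Section Extension.

Variables (R : ks -> ks -> Prop) (hR : partial_aut R) (x : ks).

Lemma min_pair_exists : exists p q, min_pair R x p q.
Proof.
pose P m := `[< exists p q, [/\ coefwise R p q, p != 0, root p x & size p = m] >].
have exP : exists m, P m.
  have [p [sp rp]] := hks.1 x; exists (size (map_poly i p)); apply/asboolP.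
  exists (map_poly i p), (map_poly i p); split=> //; first exact: coefwise_map.
  by rewrite map_poly_eq0; exact: separable_poly_neq0.
case: (ex_minnP exP) => m /asboolP[p [q [h p0 rp sp]]] hm.
exists p, q; split=> // p' q' h' rp'; rewrite sp ltnNge => /negP H.
apply/eqP/negP => /negP p'0; apply: H; apply: hm; apply/asboolP.
by exists p', q'.
Qed.

Variables (p q : {poly ks}) (hpq : min_pair R x p q).

(* Pseudo-division by the minimal pair, whose leading coefficients need not be
   invertible inside [R]. *)
Lemma min_pair_dvd p' q' : coefwise R p' q' -> root p' x ->
  (p %| p') /\ (q %| q').
Proof.
case: hpq => h p0 rp hmin.
have sq : size p = size q := coefwise_size hR h.
have q0 : q != 0 by rewrite -size_poly_eq0 -sq size_poly_eq0.
have lp : lead_coef p != 0 by rewrite lead_coef_eq0.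
have lq : lead_coef q != 0 by rewrite lead_coef_eq0.
have [m] := ubnP (size p'); elim: m p' q' => // m IH p' q' sm h' rp'.
have sq' : size p' = size q' := coefwise_size hR h'.
case: (ltnP (size p') (size p)) => [lt|ge].
  have e := hmin _ _ h' rp' lt; rewrite e dvdp0.
  move: sq'; rewrite e size_poly0 => /esym/eqP.
  by rewrite size_poly_eq0 => /eqP ->; rewrite dvdp0.
pose d := (size p' - size p)%N.
pose up := (lead_coef p')%:P * 'X^d; pose uq := (lead_coef q')%:P * 'X^d.
(* The two pseudo-remainders are built by the same formula, so they are again related by [R]. *)
pose r := (lead_coef p)%:P * p' - up * p.
pose t := (lead_coef q)%:P * q' - uq * q.
have hl : R (lead_coef p) (lead_coef q) by rewrite !lead_coefE -sq; exact: h.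
have hl' : R (lead_coef p') (lead_coef q') by rewrite !lead_coefE -sq'; exact: h'.
have hrt : coefwise R r t.
  apply: (coefwiseB hR); apply: (coefwiseM hR) => //; first exact: coefwiseC.
  by apply: (coefwiseM hR); [exact: coefwiseC|exact: coefwiseXn].
have rr : root r x.
  by rewrite /root /r hornerD hornerN !hornerM (rootP rp) (rootP rp') !mulr0 subr0.
have sr : (size r < m)%N.
  have p'0 : p' != 0.
    by rewrite -size_poly_gt0; apply: leq_trans ge; rewrite size_poly_gt0.
  have s0 : (0 < size p')%N by rewrite size_poly_gt0.
  apply: (@leq_trans (size p')); last by rewrite -ltnS.
  rewrite -(prednK s0) ltnS; apply/leq_sizeP => j.
  (* At index [(size p').-1] the two leading products cancel; beyond it both terms vanish. *)
  rewrite leq_eqVlt => /orP[/eqP <-|].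
    rewrite coefB coefCM /up -mulrA coefCM coefXnM.
    have -> : ((size p').-1 < d)%N = false.
      by apply/negbTE; rewrite -leqNgt /d -subn1 leq_sub2l // size_poly_gt0.
    have -> : ((size p').-1 - d = (size p).-1)%N.
      by rewrite /d -!subn1 subnAC subKn.
    by rewrite -!lead_coefE mulrC subrr.
  rewrite prednK // => sj; rewrite coefB coefCM /up -mulrA coefCM coefXnM.
  rewrite nth_default // mulr0 sub0r.
  case: ltnP => sd; first by rewrite mulr0 oppr0.
  rewrite nth_default ?mulr0 ?oppr0 // leq_subRL //.
  by rewrite /d subnK.
have [d1 d2] := IH _ _ sr hrt rr.
split.
  have -> : p' = (lead_coef p)^-1 *: (r + up * p).
    by rewrite /r subrK mul_polyC scalerA mulVf ?scale1r.
  by rewrite dvdpZr ?invr_eq0 // dvdp_add // dvdp_mull.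
have -> : q' = (lead_coef q)^-1 *: (t + uq * q).
  by rewrite /t subrK mul_polyC scalerA mulVf ?scale1r.
by rewrite dvdpZr ?invr_eq0 // dvdp_add // dvdp_mull.
Qed.

(** A separable polynomial over [k] that kills [x] is paired with itself, so [q] divides it by
    [min_pair_dvd]. *)
Lemma min_pair_separable : separable_poly q.
Proof.
have [P [sP rP]] := hks.1 x.
have [_ dq] := min_pair_dvd (coefwise_map hR P) rP.
by apply: dvdp_separable dq _; rewrite separable_map.
Qed.

Lemma min_pair_size : (1 < size q)%N.
Proof.
by case: hpq => h p0 rp _; rewrite -(coefwise_size hR h); apply: root_size_gt1 rp.
Qed.

(** The extension sends [p'.[x]] to [q'.[y]]. It is well defined because [p'.[x] = 0] forces [q] to
    divide [q'], hence [q'.[y] = 0]. *)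
Lemma min_pair_extend y : root q y ->
  exists R', [/\ partial_aut R', (forall a b, R a b -> R' a b) & R' x y].
Proof.
move=> rq.
exists (fun a b => exists p' q', [/\ coefwise R p' q', a = p'.[x] & b = q'.[y]]).
split; first split.
- move=> a; exists (i a)%:P, (i a)%:P; rewrite !hornerC; split=> //.
  by apply: (coefwiseC hR); exact: paut_base.
- move=> ? ? ? ? [p1 [q1 [h1 -> ->]]] [p2 [q2 [h2 -> ->]]].
  exists (p1 - p2), (q1 - q2); rewrite !hornerD !hornerN.
  by split=> //; exact: coefwiseB.
- move=> ? ? ? ? [p1 [q1 [h1 -> ->]]] [p2 [q2 [h2 -> ->]]].
  by exists (p1 * p2), (q1 * q2); rewrite !hornerM; split=> //; exact: coefwiseM.
- move=> b [p' [q' [h' e ->]]]; apply/rootP.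
  have [_ /dvdpP[u ->]] := min_pair_dvd h' (introT rootP (esym e)).
  by rewrite rootM rq orbT.
- move=> a b hab; exists a%:P, b%:P; rewrite !hornerC; split=> //.
  exact: coefwiseC.
- by exists 'X, 'X; rewrite !hornerX; split=> //; exact: coefwiseX.
Qed.

End Extension.

(** * Extension to all of [ks] by Zorn's lemma *)

Lemma partial_aut_extend R x : partial_aut R ->
  exists y R', [/\ partial_aut R', (forall a b, R a b -> R' a b) & R' x y].
Proof.
move=> hR; have [p [q hpq]] := min_pair_exists hR x.
have [y ry] := hks.2 q (min_pair_separable hR hpq) (min_pair_size hR hpq).
by have [R' hR'] := min_pair_extend hR hpq ry; exists y, R'.
Qed.

Lemma partial_aut_maximal R : partial_aut R ->
  exists M, [/\ partial_aut M, (forall a b, R a b -> M a b) &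
    forall M', partial_aut M' -> (forall a b, M a b -> M' a b) ->
      forall a b, M' a b -> M a b].
Proof.
move=> hR.
(* Adjoining [R] to every set keeps the maximal element above [R] and makes the union of the empty
   chain admissible. *)
pose rel_of (A : classical_sets.set (ks * ks)) a b := R a b \/ A (a, b).
have [F chF total_F|A [PA maxA]] := @classical_sets.Zorn_bigcup _
    (fun A => partial_aut (rel_of A)).
  (* Each axiom involves at most two related pairs, and these already lie in one member of the
     chain, or in [R] itself. *)
  have two a b a' b' : rel_of (classical_sets.bigcup F id) a b ->
      rel_of (classical_sets.bigcup F id) a' b' ->
      exists A, [/\ partial_aut (rel_of A),
        forall u v, rel_of A u v -> rel_of (classical_sets.bigcup F id) u v,
        rel_of A a b & rel_of A a' b'].
    have up A : F A -> forall u v, rel_of A u v ->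
        rel_of (classical_sets.bigcup F id) u v.
      by move=> FA u v [h|h]; [left|right; exists A].
    have lo (e : ks * ks -> Prop) : F e -> partial_aut (rel_of e) by exact: chF.
    move=> [h|[A FA /= h]] [h'|[A' FA' /= h']].
    - exists classical_sets.set0; split; try by left.
        suff -> : rel_of classical_sets.set0 = R by [].
        by apply/funext => u; apply/funext => v; apply/propext; split=> [[]|] //; left.
      by move=> u v [] // ?; left.
    - by exists A'; split; [exact: lo|exact: up|left|right].
    - by exists A; split; [exact: lo|exact: up|right|left].
    - have [s|s] := total_F _ _ FA FA'.
        by exists A'; split; [exact: lo|exact: up|right; exact: s|right].
      by exists A; split; [exact: lo|exact: up|right|right; exact: s].
  split=> [a|a b a' b' h h'|a b a' b' h h'|b h].
  - by left; exact: paut_base.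
  - by have [A [hA up h1 h2]] := two _ _ _ _ h h'; apply: up; exact: pautB.
  - by have [A [hA up h1 h2]] := two _ _ _ _ h h'; apply: up; exact: pautM.
  - by have [A [hA _ h1 _]] := two _ _ _ _ h h; exact: paut0 hA _ h1.
exists (rel_of A); split=> // [a b|M' hM' sub a b hab]; first by left.
apply: contrapT => nab.
apply: (maxA (fun u => M' u.1 u.2)).
  split=> [[u v] h|]; first by apply: sub; right.
  by move=> s; apply: nab; right; exact: (s (a, b)).
suff -> : rel_of (fun u => M' u.1 u.2) = M' by [].
apply/funext => u; apply/funext => v; apply/propext; split=> [[h|//]|]; last by right.
by apply: sub; left.
Qed.

Lemma galAut_of_fun (phi : ks -> ks) : bijective phi ->
  (forall a, phi (i a) = i a) -> {morph phi : a b / a - b} ->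
  {morph phi : a b / a * b} -> exists s : galAut i, s =1 phi.
Proof.
move=> bphi phik phiB phiM.
have phi1 : phi 1 = 1 by rewrite -(rmorph1 i).
pose am := GRing.isZmodMorphism.Build ks ks phi phiB.
pose mm := GRing.isMonoidMorphism.Build ks ks phi (conj phi1 phiM).
pose phiR : {rmorphism ks -> ks} := HB.pack phi am mm.
have hk (x : k) : phiR (kalg_map (kAlg_sep i) x) = kalg_map (kAlg_sep i) x.
  by [].
by exists (@GalAut k ks i (@KHom k (kAlg_sep i) (kAlg_sep i) phiR hk) bphi).
Qed.

(** A maximal extension is defined everywhere by [partial_aut_extend], and it is surjective by the
    same argument for the converse relation. *)
Lemma partial_aut_total R : partial_aut R ->
  exists s : galAut i, forall a b, R a b -> s a = b.
Proof.
move=> hR; have [M [hM subM maxM]] := partial_aut_maximal hR.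
have totM x : exists y, M x y.
  have [y [M' [hM' sub h]]] := partial_aut_extend x hM.
  by exists y; exact: maxM hM' sub _ _ h.
have surM y : exists x, M x y.
  have [x [M' [hM' sub h]]] := partial_aut_extend y (partial_aut_sym hM).
  exists x; apply: (maxM (fun a b => M' b a)) => //; first exact: partial_aut_sym.
  by move=> a b; exact: sub.
have [phi hphi] := choice totM; have [psi hpsi] := choice surM.
have E a b : M a b -> phi a = b by move=> h; exact: paut_fun hM _ _ _ (hphi a) h.
have E' a b : M a b -> psi b = a.
  by move=> h; exact: (paut_fun (partial_aut_sym hM) (hpsi b) h).
have [||||s hs] := @galAut_of_fun phi.
- by exists psi => a; [exact: E'|exact: E].
- by move=> a; apply: E; exact: paut_base.
- by move=> a b; apply: E; exact: pautB.
- by move=> a b; apply: E; exact: pautM.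
by exists s => a b h; rewrite hs; apply: E; exact: subM.
Qed.

(** * The fixed field of the automorphisms *)

Lemma partial_aut_id : partial_aut (fun x y => exists2 a, x = i a & y = i a).
Proof.
split.
- by move=> a; exists a.
- by move=> _ _ _ _ [a -> ->] [b -> ->]; exists (a - b); rewrite rmorphB.
- by move=> _ _ _ _ [a -> ->] [b -> ->]; exists (a * b); rewrite rmorphM.
- move=> _ [a /esym/eqP h ->]; move: h.
  by rewrite fmorph_eq0 => /eqP ->; rewrite rmorph0.
Qed.

(** If the minimal polynomial of [x] over [k] had degree at least 2, separability would give a root
    [y] other than [x], and some automorphism would send [x] to [y]. So the degree is 1 and [x] is a
    quotient of coefficients. *)
Lemma galois_fixed x : (forall s : galAut i, s x = x) -> exists a, x = i a.
Proof.
move=> hx; have hR := partial_aut_id.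
have [p [q hpq]] := min_pair_exists hR x.
case: (hpq) => h p0 rp _.
have epq : p = q.
  by apply/polyP => j; case: (h j) => a -> ->.
have sepq := min_pair_separable hR hpq; have s1 := min_pair_size hR hpq.
rewrite -epq in sepq s1; have [u Eu] := factor_theorem _ _ rp.
have u0 : u != 0 by apply: contraNneq p0 => e; rewrite Eu e mul0r.
have su : size p = (size u).+1.
  by rewrite Eu size_Mmonic ?monicXsubC // size_XsubC addnC.
(* Separability of [p] makes the cofactor [u] separable and keeps [x] from being a root of it. *)
move: sepq; rewrite {1}Eu separable_root => /andP[sepu nrx].
case: (ltnP 1 (size u)) => [lu|lu].
  have [y ry] := hks.2 u sepu lu.
  have rqy : root q y by rewrite -epq Eu rootM ry.
  have [R' [hR' _ R'xy]] := min_pair_extend hR hpq rqy.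
  have [s hs] := partial_aut_total hR'.
  by move: nrx; rewrite -(hx s) (hs _ _ R'xy) ry.
have s2 : size p = 2.
  by apply/eqP; rewrite eqn_leq s1 andbT su ltnS.
have [a ea _] := h 1%N; have [b eb _] := h 0%N.
have a0 : i a != 0.
  have : lead_coef p != 0 by rewrite lead_coef_eq0.
  by rewrite lead_coefE s2 ea.
exists (- b / a); rewrite rmorphM rmorphN fmorphV.
apply: (mulIf a0); rewrite mulfVK //; apply/eqP; rewrite -addr_eq0.
move: rp; rewrite /root horner_coef s2 !big_ord_recl big_ord0 /= ea eb.
by rewrite expr0 mulr1 addr0 expr1 addrC [x * _]mulrC.
Qed.

Lemma galois_fixed_mx m n (x : 'M[ks]_(m, n)) :
  (forall s : galAut i, map_mx s x = x) -> exists w : 'M[k]_(m, n), map_mx i w = x.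
Proof.
move=> hx.
have H (e : 'I_m * 'I_n) : exists a, x e.1 e.2 = i a.
  by apply: galois_fixed => s; rewrite -[in RHS](hx s) mxE.
have [w hw] := choice H; exists (\matrix_(a, b) w (a, b)).
by apply/matrixP => a b; rewrite !mxE -(hw (a, b)).
Qed.

End PartialAutomorphisms.

(** * Automorphisms of [ks] and their finite orbits *)

Section GaloisGroup.

Variables (k ks : fieldType) (i : {rmorphism k -> ks}).

Lemma galAut_ext (s t : galAut i) : s =1 t -> s = t.
Proof.
case: s t => [s bs] [t bt] /= st; have e : s = t by exact: kHom_ext.
by move: e bs bt {st} => -> bs bt; rewrite (Prop_irrelevance bs bt).
Qed.

Definition gal_id : galAut i :=
  @GalAut k ks i (kHom_id _) (Bijective (fun=> erefl) (fun=> erefl)).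

Lemma gal_mul11 : gal_mul gal_id gal_id = gal_id.
Proof. exact: galAut_ext. Qed.

Lemma gal_ldiv (s t : galAut i) : exists u, gal_mul s u = t.
Proof.
have [s' sK s'K] := gal_bij s; have sinj := bij_inj (gal_bij s).
have [||||r hr] := @galAut_of_fun _ _ i s'.
- by exists s.
- by move=> a; apply: sinj; rewrite s'K; exact/esym/(khom_comm s).
- by move=> a b; apply: sinj; rewrite s'K rmorphB !s'K.
- by move=> a b; apply: sinj; rewrite s'K rmorphM !s'K.
by exists (gal_mul r t); apply: galAut_ext => x /=; rewrite hr s'K.
Qed.

Lemma roots_finite (F : fieldType) (p : {poly F}) : p != 0 ->
  exists rs : seq F, forall x, root p x -> x \in rs.
Proof.
have [m] := ubnP (size p); elim: m p => // m IH p sm p0.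
have [[x /factor_theorem[q Eq]]|nr] := pselect (exists x, root p x); last first.
  by exists [::] => x rx; case: nr; exists x.
have q0 : q != 0 by apply: contraNneq p0 => e; rewrite Eq e mul0r.
have [|//|rs hrs] := IH q.
  by move: sm; rewrite Eq size_Mmonic ?monicXsubC // size_XsubC addnC.
exists (x :: rs) => y; rewrite Eq rootM root_XsubC inE => /orP[/hrs ->|->] //.
by rewrite orbT.
Qed.

Lemma gal_root (s : galAut i) (p : {poly k}) (x : ks) :
  root (map_poly i p) x -> root (map_poly i p) (s x).
Proof.
move=> /rootP e; apply/rootP; rewrite -[RHS](rmorph0 s) -[in RHS]e -horner_map.
congr (horner _ _); apply/polyP => j; rewrite !coef_map /=.
exact/esym/(khom_comm s).
Qed.

Hypothesis hks : is_separable_closure i.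

(** Each entry of [l] is a root of a nonzero polynomial over [k], so its images lie among finitely
    many roots. *)
Lemma gal_orbit_finite (l : seq ks) : exists W : seq (seq ks),
  uniq W /\ forall w, w \in W <-> exists s : galAut i, w = map s l.
Proof.
suff [W hW] : exists W : seq (seq ks), forall s : galAut i, map s l \in W.
  exists (undup [seq w <- W | `[< exists s : galAut i, w = map s l >]]).
  rewrite undup_uniq; split=> // w; rewrite mem_undup mem_filter.
  split=> [/andP[/asboolP]//|[s e]]; apply/andP; split; last by rewrite e.
  by apply/asboolP; exists s.
elim: l => [|x l [W hW]]; first by exists [:: [::]].
have [p [sp rp]] := hks.1 x.
have [|rs hrs] := @roots_finite _ (map_poly i p).
  by rewrite map_poly_eq0; exact: separable_poly_neq0.
exists [seq y :: w | y <- rs, w <- W] => s.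
apply/allpairsP; exists ((s x : ks), (map s l : seq ks)); split=> //=.
exact: hrs (gal_root s rp).
Qed.

(** * Hilbert 90 for the general linear group *)

Section Hilbert90.

Variables (n : nat) (A : galAut i -> 'M[ks]_n) (l : seq ks).
Hypothesis AM : forall s t, A (gal_mul s t) = A s *m map_mx s (A t).
Hypothesis A1 : forall s, gal_agree l gal_id s -> A s = 1%:M.

(** The quotient [u] of [t] by [s] fixes [l], so [A u] is the identity. *)
Lemma cocycle_agree (s t : galAut i) : map s l = map t l -> A s = A t.
Proof.
move=> st; have [u e] := gal_ldiv s t.
rewrite -e AM (@A1 u) ?map_mx1 ?mulmx1 // => x xl.
apply: (bij_inj (gal_bij s)); rewrite -[s (u x)]/(gal_mul s u x) e.
by move/eq_in_map: st; apply.
Qed.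

(** The rows of [N] are the transposes of vectors fixed by the twisted action that sends [x] to
    [A s *m map_mx s x]. *)
Definition descends m (N : 'M[ks]_(m, n)) : Prop :=
  forall s : galAut i, map_mx s N *m (A s)^T = N.

Variables (W : seq (seq ks)) (r : seq ks -> galAut i).
Hypothesis uW : uniq W.
Hypothesis hW : forall w, w \in W <-> exists s : galAut i, w = map s l.
Hypothesis hr : forall w, w \in W -> w = map (r w) l.

Definition equivariant (Phi : seq ks -> ks) : Prop :=
  forall (s : galAut i) w, w \in W -> Phi (map s w) = s (Phi w).

(** The Poincaré sum of the cocycle. Since [A s] depends only on [map s l], the sum over the group
    becomes a sum over the finite orbit [W], with [r] choosing representatives. *)
Definition orbit_sum (Phi : seq ks -> ks) : 'M[ks]_n :=
  \sum_(w <- W) Phi w *: A (r w).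

(** Applying [s] and multiplying by [A s] turns the term at [w] into the term at [map s w], and [s]
    permutes [W]. *)
Lemma orbit_sum_descends Phi : equivariant Phi -> descends (orbit_sum Phi)^T.
Proof.
move=> hPhi s; rewrite -map_trmx -trmx_mul; congr (_^T).
have sinj := bij_inj (gal_bij s).
have pW : perm_eq W (map (map s) W).
  have usW : uniq (map (map s) W) by rewrite map_inj_uniq //; exact: inj_map.
  rewrite perm_sym; apply: uniq_perm => //.
  have [|||_] := @uniq_min_size _ (map (map s) W) W => //; last by rewrite size_map.
  move=> _ /mapP[w /hW[t ->] ->]; apply/hW; exists (gal_mul s t).
  by rewrite -map_comp.
rewrite /orbit_sum [in RHS](perm_big _ pW) big_map /=.
have -> : map_mx s (\sum_(w <- W) Phi w *: A (r w)) =
    \sum_(w <- W) s (Phi w) *: map_mx s (A (r w)).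
  pose s' : {rmorphism ks -> ks} := khom_map s.
  rewrite -[map_mx s _]/(map_mx s' _) raddf_sum; apply: eq_bigr => w _.
  exact: (map_mxZ s').
rewrite mulmx_sumr big_seq [RHS]big_seq; apply: eq_bigr => w wW.
rewrite -scalemxAr -AM -(hPhi s w wW); congr (_ *: _); apply: cocycle_agree.
have swW : map s w \in W.
  by apply/hW; exists (gal_mul s (r w)); rewrite {1}(hr wW) -map_comp.
by rewrite -(hr swW) {2}(hr wW) -map_comp.
Qed.

(* Equivariant functions separate the points of the orbit, so multiplying by
   linear factors isolates the term of [orbit_sum] at [l]. *)
Lemma orbit_sum_nondegenerate (u : 'rV[ks]_n) :
  (forall Phi, equivariant Phi -> u *m orbit_sum Phi = 0) -> u = 0.
Proof.
move=> hu.
have lW : l \in W by apply/hW; exists gal_id; rewrite /= map_id.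
pose j w := find (fun m => nth 0 w m != nth 0 l m) (seq.iota 0 (size l)).
(* As [j w'] is the first position where [w'] differs from [l], the factor [lin w'] vanishes at [w']
   but not at [l]. *)
pose lin w' w := nth 0 w (j w') - nth 0 w' (j w').
have hj w : w \in W -> w != l -> nth 0 w (j w) != nth 0 l (j w).
  move=> wW wl; have sw : size w = size l by rewrite (hr wW) size_map.
  have hh : has (fun m => nth 0 w m != nth 0 l m) (seq.iota 0 (size l)).
    apply/negPn/negP => /hasPn H; case/eqP: wl; apply: (@eq_from_nth _ 0) => // m ml.
    by apply/eqP; move: (H m); rewrite mem_iota /= add0n -sw ml negbK; apply.
  have := nth_find 0%N hh; rewrite nth_iota //.
  by move: hh; rewrite has_find size_iota.
have key W' : forall Phi, equivariant Phi ->
    \sum_(w <- W) (Phi w * \prod_(w' <- W') lin w' w) *: (u *m A (r w)) = 0.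
  elim: W' => [|w0 W' IH] Phi hPhi.
    rewrite -[RHS](hu Phi hPhi) /orbit_sum mulmx_sumr; apply: eq_bigr => w _.
    by rewrite big_nil mulr1 -scalemxAr.
  (* Coordinate functions are equivariant, so this part of the factor goes into [Phi]. The constant
     part need not be Galois invariant, and comes out of the sum as a scalar. *)
  pose Psi w := Phi w * nth 0 w (j w0).
  have hPsi : equivariant Psi.
    move=> s w wW; rewrite /Psi hPhi // [in RHS]rmorphM; congr (_ * _).
    case: (ltnP (j w0) (size w)) => h; first by rewrite (nth_map 0).
    by rewrite !nth_default ?size_map // rmorph0.
  suff -> : \sum_(w <- W)
        (Phi w * \prod_(w' <- w0 :: W') lin w' w) *: (u *m A (r w)) =
      \sum_(w <- W) (Psi w * \prod_(w' <- W') lin w' w) *: (u *m A (r w)) -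
      nth 0 w0 (j w0) *:
        \sum_(w <- W) (Phi w * \prod_(w' <- W') lin w' w) *: (u *m A (r w)).
    by rewrite !IH // scaler0 subrr.
  rewrite scaler_sumr -sumrB; apply: eq_bigr => w _.
  rewrite big_cons scalerA -scalerBl; congr (_ *: _).
  by rewrite /Psi /lin mulrBl mulrBr mulrA [_ * (Phi w * _)]mulrCA.
have /eqP := key (rem l W) (fun=> 1) (fun s w _ => esym (rmorph1 s)).
rewrite (big_rem l) //= [X in _ + X]big_seq [X in _ + X]big1 ?addr0 => [|w wW];
  last first.
  by rewrite (big_rem w) //= /lin subrr mul0r mulr0 scale0r.
rewrite (@A1 (r l)) ?mulmx1; last first.
  by move=> x xl; have := hr lW; rewrite -{1}[l]map_id => /eq_in_map; apply.
rewrite mul1r scaler_eq0 => /orP[|/eqP //].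
rewrite prodf_seq_eq0 => /hasP[w]; rewrite mem_rem_uniq // inE => /andP[wl wW] /=.
by rewrite subr_eq0 eq_sym (negPf (hj _ wW wl)).
Qed.

(** Take [N] of maximal rank. Appending an orbit sum cannot raise the rank, so every orbit sum lies
    in the row space of [N]. Hence a vector orthogonal to the rows of [N] is killed by all orbit
    sums and is zero. *)
Lemma descends_full : exists m (N : 'M[ks]_(m, n)), descends N /\ row_full N.
Proof.
pose P d := `[< exists m (N : 'M[ks]_(m, n)), descends N /\ \rank N = d >].
have exP : exists d, P d.
  exists 0%N; apply/asboolP; exists 0%N, 0; split; last exact: mxrank0.
  by move=> s; exact: flatmx0.
have [|d /asboolP[m [N [dN rN]]] maxd] := ex_maxnP exP (m := n).
  by move=> d /asboolP[m [N [_ <-]]]; exact: rank_leq_col.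
exists m, N; split=> //; rewrite -cokermx_eq0.
rewrite -trmx_eq0; apply/eqP/row_matrixP => j0; rewrite row0.
apply: orbit_sum_nondegenerate => Phi hPhi.
rewrite -row_mul -[orbit_sum Phi]trmxK -trmx_mul.
suff BN : ((orbit_sum Phi)^T <= N)%MS.
  by move: BN; rewrite submxE => /eqP ->; rewrite trmx0 row0.
pose N' := col_mx N (orbit_sum Phi)^T.
have dN' : descends N'.
  move=> s; rewrite map_col_mx mul_col_mx dN.
  by rewrite (orbit_sum_descends hPhi).
have sN : (N <= N')%MS by rewrite -addsmxE addsmxSl.
have : (N' <= N)%MS.
  rewrite -(mxrank_leqif_sup sN) eqn_leq mxrankS //= rN.
  by apply: maxd; apply/asboolP; exists (m + n)%N, N'.
by rewrite col_mx_sub => /andP[].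
Qed.

End Hilbert90.

(** Choosing [n] independent rows of a full-rank [N] gives an invertible [P] with
    [A s *m map_mx s P^T = P^T], and [g] is the inverse of [P^T]. *)
Theorem hilbert90_GL n (A : galAut i -> 'M[ks]_n) (l : seq ks) :
  (forall s t, A (gal_mul s t) = A s *m map_mx s (A t)) ->
  (forall s, gal_agree l gal_id s -> A s = 1%:M) ->
  exists g : 'M[ks]_n, g \in unitmx /\
    forall s, A s = invmx g *m map_mx s g.
Proof.
move=> AM A1; have [W [uW hW]] := gal_orbit_finite l.
have H w : exists s : galAut i, w \in W -> w = map s l.
  have [/hW[s ->]|nw] := boolP (w \in W); first by exists s.
  by exists gal_id.
have [r hr] := choice H.
have [m [N [dN fN]]] := descends_full AM A1 uW hW hr.
pose P := rowsub (fullrankfun fN) N.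
have uP : P \in unitmx := fullrowsub_unit fN.
have dP (s : galAut i) : map_mx s P *m (A s)^T = P.
  by rewrite map_mxsub mul_rowsub_mx dN.
exists (invmx P^T); rewrite unitmx_inv unitmx_tr; split=> // s.
have PV : map_mx s P^T *m map_mx s (invmx P^T) = 1%:M.
  by rewrite -map_mxM mulmxV ?unitmx_tr // map_mx1.
by rewrite invmxK -{1}[P](dP s) trmx_mul trmxK map_trmx -mulmxA PV mulmx1.
Qed.

End GaloisGroup.

(** * Group identities on points *)

Section GroupFunctorTheory.

Variables (k : fieldType) (A : groupFunctor k).

Section Points.

Variable S : kAlg k.
Implicit Types x y z : A S.

Lemma pmulVK x y : pmul (pinv x) (pmul x y) = y.
Proof. by rewrite pmulA pmulV pmul1. Qed.

Lemma pmulI x y z : pmul x y = pmul x z -> y = z.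
Proof. by move=> e; rewrite -(pmulVK x y) e pmulVK. Qed.

Lemma pmulx1 x : pmul x (pone A S) = x.
Proof. by apply: (@pmulI (pinv x)); rewrite pmulVK pmulV. Qed.

Lemma pmulxV x : pmul x (pinv x) = pone A S.
Proof. by apply: (@pmulI (pinv x)); rewrite pmulVK pmulx1. Qed.

Lemma pmulKV x y : pmul x (pmul (pinv x) y) = y.
Proof. by rewrite pmulA pmulxV pmul1. Qed.

Lemma pmulIr x y z : pmul y x = pmul z x -> y = z.
Proof.
by move=> e; rewrite -(pmulx1 y) -(pmulxV x) pmulA e -pmulA pmulxV pmulx1.
Qed.

Lemma pinv_eq x y : pmul x y = pone A S -> pinv x = y.
Proof. by move=> e; apply: (@pmulI x); rewrite pmulxV. Qed.

Lemma pinvM x y : pinv (pmul x y) = pmul (pinv y) (pinv x).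
Proof. by apply: pinv_eq; rewrite -pmulA pmulKV pmulxV. Qed.

Lemma pinv1 : pinv (pone A S) = pone A S.
Proof. by apply: pinv_eq; rewrite pmul1. Qed.

Lemma pmul_idem x : pmul x x = x -> x = pone A S.
Proof. by move=> e; apply: (@pmulI x); rewrite pmulx1. Qed.

Lemma pmulACA x y z t : commutative (@pmul k A S) ->
  pmul (pmul x y) (pmul z t) = pmul (pmul x z) (pmul y t).
Proof. by move=> C; rewrite -!pmulA; congr pmul; rewrite !pmulA (C y). Qed.

End Points.

Lemma pmap_one S T (u : kHom S T) : pmap A u (pone A S) = pone A T.
Proof. by apply: pmul_idem; rewrite -pmap_mul pmul1. Qed.

Lemma pmap_inv S T (u : kHom S T) (x : A S) :
  pmap A u (pinv x) = pinv (pmap A u x).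
Proof. by apply/esym/pinv_eq; rewrite -pmap_mul pmulxV pmap_one. Qed.

End GroupFunctorTheory.

(** * Evaluation of polynomials and algebra morphisms *)

Section Evaluation.

Variables (k : fieldType) (S T : kAlg k) (u : kHom S T).

Lemma khom_mmap m (h : 'I_m -> S) (p : {mpoly k[m]}) :
  u (mmap (kalg_map S) h p) = mmap (kalg_map T) (fun j => u (h j)) p.
Proof.
rewrite /mmap rmorph_sum; apply: eq_bigr => a _; rewrite rmorphM khom_comm.
rewrite /mmap1 rmorph_prod; congr (_ * _); apply: eq_bigr => b _.
by rewrite rmorphXn.
Qed.

Lemma evalV_map n (v : 'cV[S]_n) (p : {mpoly k[n]}) :
  evalV (map_mx u v) p = u (evalV v p).
Proof.
rewrite /evalV khom_mmap; congr (mmap _ _ p).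
by apply/funext => j; rewrite mxE.
Qed.

End Evaluation.

(** * Continuous cochains and the Galois action on points *)

Section Continuity.

Variables (k ks : fieldType) (i : {rmorphism k -> ks}).

Lemma continuous1_cst T (x : T) : continuous1 (fun _ : galAut i => x).
Proof. by move=> s; exists [::]. Qed.

Lemma continuous1_op T U X (op : T -> U -> X) (c : galAut i -> T) c' :
  continuous1 c -> continuous1 c' -> continuous1 (fun s => op (c s) (c' s)).
Proof.
move=> hc hc' s; have [l hl] := hc s; have [l' hl'] := hc' s.
exists (l ++ l') => s' h; rewrite hl ?hl' // => x xl; apply: h.
  by rewrite mem_cat xl orbT.
by rewrite mem_cat xl.
Qed.

Lemma continuous1_inj T U (phi : T -> U) (c : galAut i -> T) : injective phi ->
  continuous1 (fun s => phi (c s)) -> continuous1 c.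
Proof.
by move=> inj hc s; have [l hl] := hc s; exists l => s' /hl /inj.
Qed.

(** The point [h] is a morphism [phi] out of a finitely generated algebra, so its conjugate by [s]
    is determined by the action of [s] on the images of the generators. *)
Lemma continuous1_gal_act (G : groupFunctor k) (h : G (kAlg_sep i)) :
  algebraic_group G -> continuous1 (fun s : galAut i => gal_act s h).
Proof.
move=> [O [u [repr [m [gen hgen]]]]] s.
have [phi [e _]] := repr _ h; exists [seq (phi (gen j) : ks) | j : 'I_m] => s' ss'.
rewrite -e /gal_act -!pmap_comp; congr (pmap G _ u); apply: kHom_ext => a /=.
have [p ->] := hgen a; rewrite !khom_mmap; congr (mmap _ _ p).
by apply/funext => j; apply/esym/ss'; exact: map_f (mem_enum _ _).
Qed.

Lemma gal_actM (A : groupFunctor k) (s : galAut i) (x y : A (kAlg_sep i)) :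
  gal_act s (pmul x y) = pmul (gal_act s x) (gal_act s y).
Proof. exact: pmap_mul. Qed.

Lemma gal_actV (A : groupFunctor k) (s : galAut i) (x : A (kAlg_sep i)) :
  gal_act s (pinv x) = pinv (gal_act s x).
Proof. exact: pmap_inv. Qed.

Lemma gal_act1 (A : groupFunctor k) (s : galAut i) :
  gal_act s (pone A (kAlg_sep i)) = pone A _.
Proof. exact: pmap_one. Qed.

Lemma gal_act_comp (A : groupFunctor k) (s t : galAut i) (x : A (kAlg_sep i)) :
  gal_act (gal_mul s t) x = gal_act s (gal_act t x).
Proof. exact: pmap_comp. Qed.

Lemma Z1_id (A : groupFunctor k) (c : galAut i -> A (kAlg_sep i)) :
  Z1 c -> c (gal_id i) = pone A _.
Proof.
move=> [_ h]; have := h (gal_id i) (gal_id i).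
rewrite gal_mul11 /gal_act [pmap A _ _]pmap_id => e.
exact/pmul_idem.
Qed.

Lemma coboundM (A : groupFunctor k) (e e' : galAut i -> A (kAlg_sep i)) s t :
  commutative_group A ->
  cobound (fun r => pmul (e r) (e' r)) s t =
  pmul (cobound e s t) (cobound e' s t).
Proof.
move=> C; rewrite /cobound gal_actM.
rewrite (pmulACA _ _ _ _ (C _)) pinvM.
by rewrite (C _ (pinv (e' _))) (pmulACA _ _ _ _ (C _)).
Qed.

Lemma Z2_one (A : groupFunctor k) :
  Z2 (fun _ _ : galAut i => pone A (kAlg_sep i)).
Proof.
split; first by move=> s t; exists [::].
by move=> s t r; rewrite gal_act1.
Qed.

Lemma cobound_one (A : groupFunctor k) (s t : galAut i) :
  cobound (fun=> pone A (kAlg_sep i)) s t = pone A _.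
Proof. by rewrite /cobound gal_act1 pinv1 !pmul1. Qed.

End Continuity.

(** * Twisted fixed points and rational points of twisted fibers *)

Section Fiber.

Variables (k ks : fieldType) (i : {rmorphism k -> ks}).
Variables (G : groupFunctor k) (n : nat) (rho : representation G n).
Variable f : quotient_point rho.

Lemma fiber_rep (S : kAlg k) (h : G S) (v : 'cV[S]_n) :
  fiber f v -> fiber f (rep_mx rho h *m v).
Proof.
move=> hv p; rewrite -hv.
by have := inv_polyP p; rewrite unfold_in => /asboolP; exact.
Qed.

Lemma fiber_map (S T : kAlg k) (u : kHom S T) (v : 'cV[S]_n) :
  fiber f v -> fiber f (map_mx u v).
Proof. by move=> hv p; rewrite evalV_map hv khom_comm. Qed.

Lemma fiber_map_inj (S T : kAlg k) (u : kHom S T) (v : 'cV[S]_n) :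
  injective u -> fiber f (map_mx u v) -> fiber f v.
Proof. by move=> uI hv p; apply: uI; rewrite -evalV_map hv khom_comm. Qed.

Definition sep_hom : kHom (kAlg_base k) (kAlg_sep i) :=
  @KHom k (kAlg_base k) (kAlg_sep i) i (fun=> erefl).

Lemma rep_mulK (S : kAlg k) (h : G S) (v : 'cV[S]_n) :
  rep_mx rho (pinv h) *m (rep_mx rho h *m v) = v.
Proof. by rewrite mulmxA -rep_mul pmulV rep_one mul1mx. Qed.

Definition twisted_fixed (c : galAut i -> G (kAlg_sep i)) (v : 'cV[ks]_n) :=
  forall s : galAut i, rep_mx rho (c s) *m map_mx s v = v.

Hypothesis hks : is_separable_closure i.

(** With [g] from Hilbert 90, [s(g v) = g rho(c_s) s(v) = g v], so [g v] is rational. Continuity of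
    [c] at the identity supplies the list [l]. *)
Lemma twisted_fixed_trivialize c (v : 'cV[ks]_n) : Z1 c ->
  fiber f (v : 'cV[kAlg_sep i]_n) -> twisted_fixed c v ->
  exists g : 'M[ks]_n, trivializes rho g c /\
    exists w : 'cV[k]_n, twisted_fiber i f g w.
Proof.
move=> Zc hv fv; have [l hl] := Zc.1 (gal_id i).
have [s t||g [ug hg]] := @hilbert90_GL _ _ _ hks n (fun s => rep_mx rho (c s)) l.
- by rewrite Zc.2 rep_mul rep_nat.
- by move=> s /hl ->; rewrite Z1_id // rep_one.
exists g; split; first by split.
have [s|w hw] := @galois_fixed_mx _ _ _ hks n 1 (g *m v).
  have e : map_mx s g = g *m rep_mx rho (c s) by rewrite hg mulKVmx.
  by rewrite [map_mx s _]map_mxM /= e -mulmxA fv.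
by exists w, v.
Qed.

(** As [w = g v] is rational, [rho(c_s) s(v) = g^-1 s(g v) = g^-1 w = v]. *)
Lemma trivialize_twisted_fixed c (g : 'M[ks]_n) (w : 'cV[k]_n) :
  trivializes rho g c -> twisted_fiber i f g w ->
  exists v : 'cV[ks]_n, fiber f (v : 'cV[kAlg_sep i]_n) /\ twisted_fixed c v.
Proof.
move=> [ug hg] [v [hv e]]; exists v; split=> // s.
rewrite hg -mulmxA -[map_mx s g *m _]map_mxM -e -map_mx_comp.
rewrite (eq_map_mx _ (khom_comm s)) [map_mx _ w]e.
by rewrite mulKmx.
Qed.

(** The rational point is [h v], since [s(h v) = h c_s s(v) = h v]. *)
Lemma coboundary_twisted_fixed c (h : G (kAlg_sep i)) (v : 'cV[ks]_n) :
  (forall s, c s = pmul (pinv h) (gal_act s h)) ->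
  fiber f (v : 'cV[kAlg_sep i]_n) -> twisted_fixed c v ->
  exists w : 'cV[k]_n, fiber f (w : 'cV[kAlg_base k]_n).
Proof.
move=> hc hv fv.
have [s|w hw] := @galois_fixed_mx _ _ _ hks n 1 (rep_mx rho h *m v).
  rewrite [map_mx s _]map_mxM -[map_mx s (rep_mx _ _)]rep_nat.
  rewrite -[in RHS](fv s) [in RHS]mulmxA -rep_mul hc pmulKV.
  by [].
exists w; apply: (@fiber_map_inj _ _ sep_hom); first exact: fmorph_inj.
by rewrite [map_mx _ w]hw; exact: fiber_rep.
Qed.

End Fiber.

(** * The obstruction class and twisted fixed points *)

Section ObstructionClass.

Variables (k ks : fieldType) (i : {rmorphism k -> ks}).
Variables (G : groupFunctor k) (n : nat) (rho : representation G n).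
Variable f : quotient_point rho.
Variable D : stabilizer_descent i f.
Implicit Types (v : 'cV[ks]_n) (s t : galAut i).

Lemma iota_one v : fiber f (v : 'cV[kAlg_sep i]_n) ->
  iota D v (pone D _) = pone G _.
Proof. by move=> hv; apply: pmul_idem; rewrite -iota_mul // pmul1. Qed.

Lemma iota_inv v b : fiber f (v : 'cV[kAlg_sep i]_n) ->
  iota D v (pinv b) = pinv (iota D v b).
Proof.
by move=> hv; apply/esym/pinv_eq; rewrite -iota_mul // pmulxV iota_one.
Qed.

(** Conjugation by [g] carries the stabilizer of [s(v)] to that of [v], compatibly with [iota]. This
    moves [g_s] past elements of the stabilizer in the cocycle computations. *)
Lemma iota_twist v s (g : G (kAlg_sep i)) b : fiber f (v : 'cV[kAlg_sep i]_n) ->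
  rep_mx rho g *m map_mx s v = v ->
  pmul g (gal_act s (iota D v b)) = pmul (iota D v (gal_act s b)) g.
Proof.
move=> hv e; rewrite iota_gal //.
have := @iota_conj _ _ _ _ _ _ _ D _ (fiber_map s hv) g (gal_act s b).
rewrite e => ->.
by rewrite -!pmulA pmulV pmulx1.
Qed.

Lemma df_trivial_twisted_fixed v g (d : galAut i -> galAut i -> D (kAlg_sep i)) e :
  df_cocycle v g d -> continuous1 e ->
  (forall s t, pone D _ = pmul (d s t) (cobound e s t)) ->
  Z1 (fun s => pmul (iota D v (e s)) (g s)) /\
  twisted_fixed rho (fun s => pmul (iota D v (e s)) (g s)) v.
Proof.
move=> [hv cg fg hd] ce de; split; last first.
  move=> s; rewrite rep_mul -mulmxA fg.
  by apply/(iota_img D hv); exists (e s).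
split.
  by apply: (continuous1_op (fun b x => pmul (iota D v b) x)).
move=> s t; rewrite gal_actM.
(* The relation that trivializes [d], solved for [e_st] in the commutative group [D]. *)
have -> : e (gal_mul s t) = pmul (pmul (e s) (gal_act s (e t))) (d s t).
  apply: (@pmulIr _ _ _ (pinv (e (gal_mul s t)))); rewrite pmulxV (de s t).
  rewrite (Gf_comm (d s t)) /cobound -!pmulA; congr pmul; congr pmul.
  exact: Gf_comm.
rewrite !iota_mul // hd -!pmulA pmulV pmulx1; congr pmul.
by rewrite !pmulA (iota_twist _ hv (fg s)).
Qed.

(** With [h v = v'], the choices [c] at [v] and [g'] at [v'] differ by elements [x_s] of the
    stabilizer of [v]. Since [c] is a cocycle, [d] is the coboundary of the cochain that [iota] maps
    to [x]. *)
Lemma df_cocycle_cobound v (c : galAut i -> G (kAlg_sep i)) v' g'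
    (d : galAut i -> galAut i -> D (kAlg_sep i)) :
  algebraic_group G -> transitive_on_fiber i f -> Z1 c ->
  fiber f (v : 'cV[kAlg_sep i]_n) -> twisted_fixed rho c v ->
  df_cocycle v' g' d ->
  exists e, continuous1 e /\ forall s t, d s t = cobound e s t.
Proof.
move=> aG tr [cc Mc] hv fv [hv' cg' fg' hd].
have [h eh] := tr.2 _ _ hv hv'.
pose x s := pmul (pmul (pinv h) (pmul (g' s) (gal_act s h))) (pinv (c s)).
have xv s : fixes rho v (x s).
  rewrite /fixes /x -{1}(fv s) !rep_mul -!mulmxA rep_mulK.
  have -> : rep_mx rho (gal_act s h) *m map_mx s v = map_mx s v'.
    by rewrite rep_nat -eh [in RHS]map_mxM.
  by rewrite fg' -eh rep_mulK.
have H s : exists b, iota D v b = x s by apply/iota_img.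
have [e he] := choice H; exists e; split.
  apply: (continuous1_inj (iota_inj hv)).
  have -> : (fun s => iota D v (e s)) = x by apply/funext.
  apply: (continuous1_op (fun a b => pmul a (pinv b))) => //.
  apply: (continuous1_op (fun a b => pmul (pinv h) (pmul a b))) => //.
  exact: continuous1_gal_act.
move=> s t; apply: (iota_inj hv'); rewrite hd -eh iota_conj // /cobound.
have eg r : pmul (g' r) (gal_act r h) = pmul (pmul h (iota D v (e r))) (c r).
  by rewrite he /x -!pmulA pmulV pmulx1 pmulKV.
rewrite !iota_mul // iota_inv //.
(* This right factor cancels the inverse of [g'_st] and lets [eg] replace each [g'_r r(h)]. *)
apply: (@pmulIr _ _ _ (pmul (g' (gal_mul s t)) (gal_act (gal_mul s t) h))).
rewrite -[LHS]pmulA pmulVK gal_act_comp -pmulA -gal_actM eg 2!gal_actM.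
rewrite -gal_act_comp eg !Mc -!pmulA !pmulVK.
rewrite [pmul (g' s) _]pmulA eg -!pmulA; congr pmul; congr pmul.
by rewrite !pmulA (iota_twist _ hv (fv s)).
Qed.

Lemma df_zero_twisted_fixed :
  algebraic_group G -> transitive_on_fiber i f ->
  df D = H2_zero i D <->
  exists c : galAut i -> G (kAlg_sep i), Z1 c /\
    exists v, fiber f (v : 'cV[kAlg_sep i]_n) /\ twisted_fixed rho c v.
Proof.
move=> aG tr; split=> [E|[c [Zc [v [hv fv]]]]].
  have : H2_zero i D (fun _ _ => pone D _).
    split; first exact: Z2_one.
    exists (fun=> pone D _); split; first exact: continuous1_cst.
    by move=> s t; rewrite cobound_one pmul1.
  (* The constant cocycle 1 lies in the zero class, hence in [df D]; this membership yields the
     cochain [e]. *)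
  rewrite -E => -[v [g [d [hd [_ [e [ce de]]]]]]].
  have [Zc fv] := df_trivial_twisted_fixed hd ce de.
  by exists (fun s => pmul (iota D v (e s)) (g s)); split=> //; exists v; case: hd.
apply/funext => d'; apply/propext; split.
  move=> [v' [g' [d [hd [Zd' [e' [ce' de']]]]]]]; split=> //.
  have [e [ce de]] := df_cocycle_cobound aG tr Zc hv fv hd.
  exists (fun s => pmul (e s) (e' s)); split; first exact: continuous1_op.
  by move=> s t; rewrite pmul1 coboundM ?de' ?de //; exact: Gf_comm.
(* The cocycle [c] is itself an admissible choice of [g], and its 2-cocycle is constantly 1. *)
move=> hd'; exists v, c, (fun _ _ => pone D _); split=> //; split=> //.
  by case: Zc.
by move=> s t; rewrite iota_one // Zc.2 pmulxV.
Qed.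

End ObstructionClass.

(** * The equivalences for pure inner forms and for rational points *)

Unset Implicit Arguments.

Theorem theorem2p3 (k ks : fieldType) (i : {rmorphism k -> ks})
  (hks : is_separable_closure i)
  (G : groupFunctor k) (hG : reductive G)
  (n : nat) (rho : representation G n) (f : quotient_point rho)
  (htrans : transitive_on_fiber i f) (hab : abelian_stabilizers i f)
  (D : stabilizer_descent i f) :
  (df D = H2_zero i D <->
     exists c : galAut i -> G (kAlg_sep i), Z1 c /\
       exists g : 'M[ks]_n, trivializes rho g c /\
         exists w : 'cV[k]_n, twisted_fiber i f g w) /\
  (H1_trivial i G ->
     (df D = H2_zero i D <->
        exists v : 'cV[k]_n, fiber f (v : 'cV[kAlg_base k]_n))).
Proof.
have aG : algebraic_group G by case: hG.
have E := df_zero_twisted_fixed D aG htrans.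
split=> [|H1]; rewrite E; split.
- move=> [c [Zc [v [hv fv]]]]; exists c; split=> //.
  exact (twisted_fixed_trivialize hks Zc hv fv).
- move=> [c [Zc [g [tg [w hw]]]]]; exists c; split=> //.
  exact: trivialize_twisted_fixed tg hw.
- move=> [c [Zc [v [hv fv]]]]; have [h hh] := H1 _ Zc.
  exact (coboundary_twisted_fixed hks hh hv fv).
(* A rational point is a fixed point for the trivial cocycle. *)
- move=> [w hw]; exists (fun=> pone G _); split.
    split; first exact: continuous1_cst.
    by move=> s t; rewrite gal_act1 pmul1.
  exists (map_mx i w); split; first exact: (fiber_map (sep_hom i) hw).
  move=> s; rewrite rep_one mul1mx -map_mx_comp.
  by rewrite (eq_map_mx _ (khom_comm s)).
Qed.
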